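(* Consider a Young tower $T:X\to X$ with invariant probability measure $\mu$ such that, for some constant $C>0$, some $q\in(1,2)$ and some $\epsilon>0$, $\mathrm{tail}_n = C n^{-q}+O(n^{-q-\epsilon})$. Then there exists $c>0$ such that for all integers $n>0$ $$\sup_{\|f\|\le 1,\ \int f\,d\mu=0}\ \int |S_n f|^q\,d\mu \ \ge\ c\,n\log n,$$ where the supremum is over Lipschitz functions $f:X\to\mathbb{R}$ and $S_nf=\sum_{i=0}^{n-1}f\circ T^i$.
   Context: A Young tower is a space $X$ with a partition $X=\bigcup_\alpha\bigcup_{0\le i<h_\alpha}\Delta_{\alpha,i}$ ($\alpha$ in a countable set, $h_\alpha$ positive integers), an ergodic probability measure $\mu$ and a map $T:X\to X$ preserving $\mu$. $T$ maps $\Delta_{\alpha,i}$ bijectively to $\Delta_{\alpha,i+1}$ if $i+1<h_\alpha$, and maps $\Delta_{\alpha,h_\alpha-1}$ bijectively to the basis $\Delta_0=\bigcup_\alpha\Delta_{\alpha,0}$. The distance is $d(x,y)=\rho^{s(x,y)}$, where $\rho\in(0,1)$ is fixed and the separation time $s(x,y)$ is the number of returns to the basis before the iterates of $x$ and $y$ are not in the same partition element. Denoting by $g$ the inverse of the jacobian of $T$ with respect to $\mu$, one assumes that there is a constant $C$ with $|\log g(x)-\log g(y)|\le C\,d(Tx,Ty)$ for all $x,y$ in the same partition element. The return time $\phi:\Delta_0\to\mathbb{N}$ is $\phi=h_\alpha$ on $\Delta_{\alpha,0}$, and $\mathrm{tail}_n=\mu\{x\in\Delta_0:\phi(x)\ge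 n\}$. The Lipschitz norm of $f:X\to\mathbb{R}$ is $\|f\|=\sup_x|f(x)|+\sup_{x,y}|f(x)-f(y)|/d(x,y)$, the second supremum being over pairs $x\neq y$ in the same partition element; $f$ is Lipschitz if $\|f\|<\infty$. *)

(* Defs.v *)
From HB Require Import structures.
From mathcomp Require Import all_boot all_order all_algebra.
From mathcomp Require Import all_classical all_reals all_analysis.
Import Order.TTheory GRing.Theory Num.Theory.
Import numFieldNormedType.Exports.

Set Implicit Arguments.
Unset Strict Implicit.
Unset Printing Implicit Defensive.

Local Open Scope classical_set_scope.
Local Open Scope ring_scope.

(* [cell a i] is the partition element $\Delta_{a,i}$; it is meaningful only
   for [i < height a]. *)
Record tower (R : realType) (X : Type) := Tower {
  tower_index : countType;
  height : tower_index -> nat;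
  cell : tower_index -> nat -> set X;
  tower_map : X -> X;
  rho : R }.

Definition base (R : realType) (X : Type) (Y : tower R X) : set X :=
  \bigcup_(a : tower_index Y) cell a 0.

Definition cell_indices (R : realType) (X : Type) (Y : tower R X) :
    set (tower_index Y * nat) := [set p | (p.2 < height p.1)%N].

Definition same_cell (R : realType) (X : Type) (Y : tower R X) (x y : X) :
    Prop :=
  exists2 p : tower_index Y * nat,
    cell_indices p & cell p.1 p.2 x /\ cell p.1 p.2 y.

Definition separated_at (R : realType) (X : Type) (Y : tower R X) (x y : X)
    (n : nat) : bool :=
  `[< ~ same_cell Y (iter n (tower_map Y) x) (iter n (tower_map Y) y) >].

(* If [N] is the first time at which the iterates lie in different partition
   elements, the returns to the basis before [N] are the times [0 < k < N] such
   that the [k]-th iterate is in the basis.  [None] stands for an infinite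
   separation time. *)
Definition separation_time (R : realType) (X : Type) (Y : tower R X)
    (x y : X) : option nat :=
  match pselect (exists n, separated_at Y x y n) with
  | left sep =>
      Some (\sum_(1 <= k < ex_minn sep)
              `[< base Y (iter k (tower_map Y) x) >] : nat)%N
  | right _ => None
  end.

Definition tower_dist (R : realType) (X : Type) (Y : tower R X) (x y : X) : R :=
  if separation_time Y x y is Some s then rho Y ^+ s else 0.

Section measured_tower.
Context {R : realType} {d : measure_display} {X : measurableType d}.
Implicit Types (mu : probability X R) (T : X -> X) (Y : tower R X).

Definition measure_preserving mu T : Prop :=
  measurable_fun [set: X] T /\
  forall B : set X, measurable B -> mu (T @^-1` B) = mu B.

Definition ergodic mu T : Prop :=
  forall B : set X, measurable B -> T @^-1` B = B ->
    mu B = 0%E \/ mu B = 1%E.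

Definition is_jacobian mu Y (J : X -> R) : Prop :=
  [/\ measurable_fun [set: X] J,
      forall x, 0 <= J x &
      forall (a : tower_index Y) (i : nat) (B : set X), (i < height a)%N ->
        measurable B -> B `<=` cell a i ->
        mu (tower_map Y @` B) = (\int[mu]_(x in B) (J x)%:E)%E].

(* [yt_image] makes the jacobian meaningful (it is automatic on standard Borel
   spaces), and [yt_dist0] says that [tower_dist] is a distance: its other
   axioms follow from the other conditions. *)
Record young_tower mu Y : Prop := YoungTower {
  yt_rho : 0 < rho Y < 1;
  yt_height : forall a : tower_index Y, (0 < height a)%N;
  yt_partition : partition (@cell_indices R X Y)
    (fun p => cell p.1 p.2) [set: X];
  yt_measurable : forall (a : tower_index Y) (i : nat), (i < height a)%N ->
    measurable (cell a i);
  yt_up : forall (a : tower_index Y) (i : nat), (i.+1 < height a)%N ->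
    set_bij (cell a i) (cell a i.+1) (tower_map Y);
  yt_top : forall a : tower_index Y,
    set_bij (cell a (height a).-1) (base Y) (tower_map Y);
  yt_image : forall (a : tower_index Y) (i : nat) (B : set X),
    (i < height a)%N -> measurable B -> B `<=` cell a i ->
    measurable (tower_map Y @` B);
  yt_preserving : measure_preserving mu (tower_map Y);
  yt_ergodic : ergodic mu (tower_map Y);
  yt_dist0 : forall x y : X, tower_dist Y x y = 0 -> x = y;
  yt_distortion : exists g : X -> R,
    [/\ forall x, 0 < g x,
        is_jacobian mu Y (fun x => (g x)^-1) &
        exists C : R, forall x y : X, same_cell Y x y ->
          `|ln (g x) - ln (g y)| <=
            C * tower_dist Y (tower_map Y x) (tower_map Y y)] }.

(* The junk value outside the basis is [0]. *)
Definition return_time Y (x : X) : nat :=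
  get [set m | exists2 a : tower_index Y, cell a 0 x & m = height a].

Definition tail mu Y (n : nat) : R :=
  fine (mu [set x | base Y x /\ (n <= return_time Y x)%N]).

Definition birkhoff_sum T (n : nat) (f : X -> R) (x : X) : R :=
  \sum_(i < n) f (iter i T x).

End measured_tower.

(* A supremum of nonnegative quantities: [maxe 0] gives it the value [0] when
   there are no such pairs, instead of [-oo]. *)
Definition lip_seminorm (R : realType) (X : Type) (Y : tower R X)
    (f : X -> R) : \bar R :=
  maxe 0%E (ereal_sup [set r : \bar R | exists x y : X,
    [/\ same_cell Y x y, x <> y &
        r = (`|f x - f y| / tower_dist Y x y)%:E]]).

Definition lip_norm (R : realType) (X : Type) (Y : tower R X) (f : X -> R) :
    \bar R :=
  (ereal_sup [set (`|f x|)%:E | x in [set: X]] + lip_seminorm Y f)%E.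

(* Main.v *)
Require Import Defs.
From HB Require Import structures.
From mathcomp Require Import all_boot all_order all_algebra.
From mathcomp Require Import all_classical all_reals all_analysis.
From mathcomp Require Import measurable_realfun zify ring lra.
Import Order.TTheory GRing.Theory Num.Theory.
Import numFieldNormedType.Exports.
Local Open Scope classical_set_scope.
Local Open Scope ring_scope.

(** For each [n] a single observable suffices.  Let [tall L] be the union of the
columns of height at least [L], [m] its measure, and [f := 1_(tall L) - m].
This [f] is constant on partition elements and bounded by 1, so its Lipschitz
norm is at most 1 whatever [L] is; its integral vanishes; and
[S_n f = W - n m], where [W] counts the visits to [tall L] before time [n].

The count [W] grows along each excursion in a tall column: if at time [i < n]
the orbit sits at level [l <= i] of such a column, it has been climbing it for
the last [l + 1] times, so [W >= l + 1].  Writing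
[W^q = sum_i 1_(tall L)(T^i x) W^(q-1)] gives
  [W^q >= sum_(i < n) sum_(l <= i) (l+1)^(q-1) 1_(Lambda_l)(T^i x)],
with [Lambda_l] the points of [tall L] at level [l] ([excursion_moment_le]).
The level [l] of the columns of height at least [H > l] is pulled back by [T^l]
to their base, hence has measure [tail H] ([mu_level]).  Integrating, and using
[k^(q-1) tail k >= c / k] for [k >= L],
  [E W^q >= c (n/2) (ln (n/2) - ln L)]    ([sum_weighted_tail_ge]).

On the other side [m <= sum_l tail (max L (l+1)) <= M L^(1-q)] ([mu_tall_le]).
Take [L] of order [n^(1/q)].  Then [(n m)^q] is [O(n)], whereas
[ln n - ln L] is about [(1 - 1/q) ln n], so
[E |S_n f|^q >= 2^(-q) E W^q - (n m)^q] has order [n ln n]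
([moment_ge_ln]).

This settles all [n >= N] for some [N].  For the smaller ones, a fixed large [L]
with [m <= 1/2] works: a point at the base of a column of height at least
[max L N] stays in [tall L] up to time [n], so [S_n f >= 1/2] on a set of
positive measure independent of [n] ([moment_ge_of_tall]). *)

Set Implicit Arguments.
Unset Strict Implicit.

(** * Logarithms, powers and polynomial tails *)

Section real_estimates.
Context {R : realType}.
Implicit Types (p q c : R) (k n L N : nat).

Lemma inv_le_lnB k : (0 < k)%N ->
  (k.+1%:R)^-1 <= ln k.+1%:R - ln k%:R :> R.
Proof.
move=> k0; have kR : 0 < k%:R :> R by rewrite ltr0n.
have k1R : 0 < k.+1%:R :> R by rewrite ltr0n.
have -> : ln k.+1%:R - ln k%:R = - ln (k%:R / k.+1%:R) :> R.
  by rewrite ln_div ?posrE // opprB.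
have -> : k%:R / k.+1%:R = 1 + - (k.+1%:R)^-1 :> R.
  by rewrite -{1}[k]/(k.+1.-1) -subn1 natrB // mulrBl divff ?gt_eqF // mul1r.
rewrite lerNr; apply: le_ln1Dx.
by rewrite ltrN2 invf_lt1 // ltr1n.
Qed.

Lemma lnB_le_inv k : (0 < k)%N ->
  ln k.+1%:R - ln k%:R <= (k%:R)^-1 :> R.
Proof.
move=> k0; have kR : 0 < k%:R :> R by rewrite ltr0n.
rewrite -ln_div ?posrE ?ltr0n //.
have -> : k.+1%:R / k%:R = 1 + (k%:R)^-1 :> R.
  by rewrite -natr1 mulrDl divff ?gt_eqF // mul1r.
by apply: le_ln1Dx; rewrite (lt_trans (ltrN10 _)) // invr_gt0.
Qed.

Lemma sum_inv_ge_ln L N : (0 < L)%N -> (L <= N)%N ->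
  ln N%:R - ln L%:R <= \sum_(L <= k < N) (k%:R)^-1 :> R.
Proof.
move=> L0 LN; rewrite -(telescope_sumr (fun k => ln k%:R : R)) //.
apply: ler_sum_nat => k /andP[Lk _].
exact/lnB_le_inv/(leq_trans L0).
Qed.

(** By [1 + x <= expR x] applied to [x = p (ln (k+1) - ln k)]. *)
Lemma powR_step p k : 0 < p -> (0 < k)%N ->
  p * k.+1%:R `^ (- p - 1) <= k%:R `^ (- p) - k.+1%:R `^ (- p).
Proof.
move=> p0 k0; have kR : 0 < k%:R :> R by rewrite ltr0n.
have k1R : 0 < k.+1%:R :> R by rewrite ltr0n.
have -> : k%:R `^ (- p) =
    k.+1%:R `^ (- p) * expR (p * (ln k.+1%:R - ln k%:R)) :> R.
  by rewrite /powR !gt_eqF // -expRD; congr expR; ring.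
have -> : k.+1%:R `^ (- p - 1) = k.+1%:R `^ (- p) / k.+1%:R :> R.
  rewrite powRB; first by rewrite powRr1 ?ltW.
  by rewrite pnatr_eq0 implybT.
rewrite mulrCA -[X in _ <= _ - X]mulr1 -mulrBr ler_wpM2l ?powR_ge0 //.
rewrite lerBrDl; apply: le_trans (expR_ge1Dx _).
by rewrite lerD2l ler_wpM2l ?inv_le_lnB // ltW.
Qed.

(** Integral comparison for [sum k^(-p-1)], in telescoped form. *)
Lemma sum_powR_tail p L N : 0 < p -> (0 < L)%N -> (L <= N)%N ->
  \sum_(L <= k < N) k.+1%:R `^ (- p - 1) <= L%:R `^ (- p) / p.
Proof.
move=> p0 L0 LN; rewrite ler_pdivlMr // mulrC mulr_sumr.
apply: (@le_trans _ _ (\sum_(L <= k < N) (k%:R `^ (- p) - k.+1%:R `^ (- p)))).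
  apply: ler_sum_nat => k /andP[Lk _].
  exact/powR_step/(leq_trans L0).
rewrite -[leLHS]opprK -sumrN.
under eq_bigr do rewrite opprB.
by rewrite telescope_sumr // opprB lerBlDr lerDl powR_ge0.
Qed.

(** The constant [2 ^ q] comes from [a + b <= 2 max a b]. *)
Lemma powRD_le q (a b : R) : 0 <= q -> 0 <= a -> 0 <= b ->
  (a + b) `^ q <= 2 `^ q * (a `^ q + b `^ q).
Proof.
move=> q0 a0 b0.
wlog ab : a b a0 b0 / a <= b.
  move=> H; case/orP: (le_total a b) => [|/H]; first exact: H.
  by rewrite addrC [b `^ _ + _]addrC; apply.
apply: (@le_trans _ _ ((2 * b) `^ q)).
  by rewrite ge0_ler_powR ?nnegrE //; lra.
by rewrite powRM // ler_wpM2l ?powR_ge0 // lerDr powR_ge0.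
Qed.

Lemma eventually_powR_small (eps e : R) : 0 < eps -> 0 < e ->
  exists N, forall n, (N <= n)%N -> n%:R `^ (- eps) <= e.
Proof.
move=> eps0 e0; pose N := (Num.truncn (e `^ (- eps^-1))).+1.
exists N => n Nn.
have n0 : 0 < n%:R :> R by rewrite ltr0n (leq_trans _ Nn).
have eN : e `^ (- eps^-1) <= n%:R.
  apply: (@le_trans _ _ N%:R); last by rewrite ler_nat.
  exact/ltW/truncnS_gt.
have {}eN : (e `^ (- eps^-1)) `^ eps <= n%:R `^ eps.
  by rewrite ge0_ler_powR ?nnegrE ?powR_ge0 // ltW.
move: eN; rewrite -powRrM mulNr mulVf ?gt_eqF // (powR_inv1 (ltW e0)) => eN.
by rewrite powRN -[leRHS]invrK lef_pV2 ?posrE ?powR_gt0 ?invr_gt0.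
Qed.

(** The expansion of the tail enters only through these two-sided bounds: the
    factor [n ^ (- eps)] makes the error smaller than half of the main term. *)
Lemma bigO_tail_bounds (t : nat -> R) (C q eps : R) : 0 < C -> 0 < eps ->
  (fun n : nat => t n - C * n%:R `^ (- q))
    =O_\oo (fun n : nat => n%:R `^ (- q - eps)) ->
  exists K : nat, forall n : nat, (K <= n)%N ->
    C / 2 * n%:R `^ (- q) <= t n <= 2 * C * n%:R `^ (- q).
Proof.
move=> C0 eps0 /eqOP [M [_ HM]].
have [] := HM (`|M| + 1); first by rewrite (le_lt_trans (ler_norm _)) // ltrDl.
move=> N1 _ {HM} HN1.
have [|N2 HN2] := @eventually_powR_small eps (C / 2 / (`|M| + 1)) eps0.
  by rewrite !divr_gt0 // ltr_wpDl.
exists (maxn 1 (maxn N1 N2)) => n; rewrite !geq_max => /and3P[n0 /HN1 + /HN2].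
rewrite /= [X in _ <= _ * X]ger0_norm ?powR_ge0 //.
rewrite powRD; last by rewrite pnatr_eq0 -lt0n n0 implybT.
have := powR_ge0 (n%:R : R) (- q).
move: (_ `^ _) => A A0; move: (_ `^ _) => B.
rewrite ler_pdivlMr ?ltr_wpDl // => H1 H2.
have : `|t n - C * A| <= A * (C / 2).
  by apply: le_trans H1 _; rewrite mulrCA ler_wpM2l // mulrC.
by rewrite ler_norml => /andP[]; nra.
Qed.

(** Multiplying a tail of order [k ^ (- q)] by [k ^ (q - 1)] gives the harmonic
    series, which is where the logarithm comes from.  Only the times [i >= n/2]
    are kept: for these the inner sum runs at least over [L <= k <= n/2]. *)
Lemma sum_weighted_tail_ge (t : nat -> R) q c L n : 0 <= c -> (0 < L)%N ->
  (forall k, 0 <= t k) ->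
  (forall k, (L <= k)%N -> c * k%:R `^ (- q) <= t k) -> (0 < n)%N ->
  n%:R / 2 * (c * (ln n%:R - ln 2 - ln L%:R)) <=
  \sum_(i < n) \sum_(l < i.+1) l.+1%:R `^ (q - 1) * t (maxn L l.+1).
Proof.
move=> c0 L0 t0 tc n0.
have n0R : 0 < n%:R :> R by rewrite ltr0n.
have L0R : 0 < L%:R :> R by rewrite ltr0n.
have terms_ge0 l : 0 <= l.+1%:R `^ (q - 1) * t (maxn L l.+1).
  by rewrite mulr_ge0 ?powR_ge0.
set D := _ - _ - _.
(* When [n / 2 <= L] the left-hand side is nonpositive. *)
have [D0|D0] := leP D 0.
  apply: (@le_trans _ _ 0); last by do 2 (apply: sumr_ge0 => ? _).
  by rewrite mulr_ge0_le0 ?mulr_ge0_le0 // divr_ge0.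
rewrite -(big_mkord xpredT (fun i => \sum_(l < i.+1)
  l.+1%:R `^ (q - 1) * t (maxn L l.+1))).
rewrite (big_cat_nat (n := n./2)) //=; last by lia.
rewrite ler_wpDl //; first by do 2 (apply: sumr_ge0 => ? _).
apply: (@le_trans _ _ (\sum_(n./2 <= i < n) c * D)).
  rewrite sumr_const_nat -[leRHS]mulr_natl ler_wpM2r //.
    by rewrite mulr_ge0 // ltW.
  by rewrite ler_pdivrMr // -natrM ler_nat; lia.
apply: ler_sum_nat => i /andP[ni _].
have n2i : (n <= 2 * i.+1)%N by lia.
have Li : (L <= i.+1)%N.
  rewrite leqNgt; apply/negP => iL; move: D0; rewrite ltNge => /negP; apply.
  rewrite /D -addrA -opprD subr_le0 -lnM ?posrE // ler_ln ?posrE ?mulr_gt0 //.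
  by rewrite -natrM ler_nat; lia.
rewrite -(big_mkord xpredT (fun l => l.+1%:R `^ (q - 1) * t (maxn L l.+1))).
rewrite (big_cat_nat (n := L.-1)) //=; last by lia.
rewrite ler_wpDl //; first by apply: sumr_ge0 => ? _.
apply: (@le_trans _ _ (\sum_(L.-1 <= l < i.+1) c * l.+1%:R^-1)).
  rewrite -mulr_sumr ler_wpM2l //.
  have -> : \sum_(L.-1 <= l < i.+1) l.+1%:R^-1 =
      \sum_(L <= k < i.+2) k%:R^-1 :> R.
    by rewrite -[in RHS](prednK L0) big_add1.
  apply: le_trans (sum_inv_ge_ln L0 (leqW Li)).
  rewrite lerD2r lerBlDr -lnM ?posrE // ler_ln ?posrE ?mulr_gt0 //.
  by rewrite -natrM ler_nat; lia.
apply: ler_sum_nat => l /andP[Ll _].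
have Ll1 : (L <= l.+1)%N by lia.
have l0 : 0 < l.+1%:R :> R by rewrite ltr0n.
rewrite (maxn_idPr Ll1); apply: le_trans (ler_wpM2l (powR_ge0 _ _) (tc _ Ll1)).
rewrite mulrCA -powRD; last by rewrite pnatr_eq0 implybT.
have -> : q - 1 + - q = -1 by ring.
by rewrite powR_inv1 // ltW.
Qed.

Lemma lee_of_le_scale_add (S B r : R) (I : \bar R) : 0 < r ->
  (S%:E <= r%:E * (I + B%:E))%E -> ((S / r - B)%:E <= I)%E.
Proof.
move=> r0; case: I => [I| |] /=; last 2 first.
- by rewrite leey.
- by rewrite addNye gt0_muleNy ?lte_fin // leeNy_eq.
by rewrite -EFinD -EFinM !lee_fin lerBlDr ler_pdivrMr // mulrC.
Qed.

End real_estimates.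

(** * Columns and their measures *)

Section columns.
Context {R : realType} {X : Type}.
Implicit Types (Y : tower R X) (H L i l n : nat).

(** Meaningful for [l < H], which makes [l] a level of every column used. *)
Definition level Y H l : set X :=
  \bigcup_(a in [set a : tower_index Y | (H <= height a)%N]) cell a l.

(** The union of the columns of height at least [L]; the threshold [maxn L l.+1]
    at level [l] restricts the union to genuine cells. *)
Definition tall Y L : set X := \bigcup_l level Y (maxn L l.+1) l.

End columns.

Section measured_columns.
Context {R : realType} {d : measure_display} {X : measurableType d}.
Context (mu : probability X R) (Y : tower R X).
Context (HY : young_tower mu Y).
Implicit Types (H L i l n : nat).
Local Notation T := (tower_map Y).

Lemma cell_unique (a b : tower_index Y) i j x : (i < height a)%N ->
  (j < height b)%N -> cell a i x -> cell b j x -> (a, i) = (b, j).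
Proof.
move=> ia jb ax bx; have [_ + _] := yt_partition HY.
move=> /(_ (a, i) (b, j) ia jb); apply.
by exists x.
Qed.

Lemma ex_cell x :
  exists (a : tower_index Y) i, (i < height a)%N /\ cell a i x.
Proof.
have [+ _ _] := yt_partition HY.
move=> /(congr1 (fun S => S x)) /= E.
have [[a i] ia ax] : cover (cell_indices (Y:=Y)) (fun p => cell p.1 p.2) x.
  by rewrite E.
by exists a, i.
Qed.

(** A point can only enter a positive level from the level just below it in the
    same column, because the top cells are mapped to the base. *)
Lemma tower_map_level H l : (l.+1 < H)%N ->
  T @^-1` level Y H l.+1 = level Y H l.
Proof.
move=> lH; apply/seteqP; split => [x [a /= Ha aTx]|x [a /= Ha ax]].
- have la := leq_trans lH Ha.
  have [b [i [ib bx]]] := ex_cell x.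
  have [ib1|ib1] := ltnP i.+1 (height b).
    have [/(_ _ bx) bTx _ _] := yt_up HY ib1.
    have [ab li] := cell_unique la ib1 aTx bTx.
    by exists a => //=; rewrite ab li.
  have iE : i = (height b).-1.
    by have -> : height b = i.+1 by apply/eqP; rewrite eqn_leq ib1 ib.
  have [/(_ x) + _ _] := yt_top HY b.
  rewrite -iE => /(_ bx) [c _ cTx].
  by have [_] := cell_unique la (yt_height HY c) aTx cTx.
- have la := leq_trans lH Ha.
  by have [/(_ _ ax) aTx _ _] := yt_up HY la; exists a.
Qed.

Lemma level_iter H l i x : (l + i < H)%N ->
  level Y H (l + i) (iter i T x) = level Y H l x.
Proof.
elim: i l x => [|i IH] l x; first by rewrite addn0.
move=> liH; rewrite iterSr addnS -addSn IH; last by rewrite addSnnS.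
have /tower_map_level <- // : (l.+1 < H)%N.
by apply: leq_ltn_trans liH; rewrite addnS ltnS leq_addr.
Qed.

Lemma measurable_level H l : (l < H)%N -> measurable (level Y H l).
Proof.
move=> lH; rewrite /level bigcup_mkcond.
apply: countable_bigcupT_measurable; first exact: countableP.
move=> a; case: ifPn => //; rewrite inE /= => Ha.
apply: (yt_measurable HY); exact: leq_trans lH Ha.
Qed.

Lemma measurable_tall L : measurable (tall Y L).
Proof.
apply: bigcup_measurable => l _; apply: measurable_level.
by rewrite leq_max ltnSn orbT.
Qed.

Lemma measurable_iter n : measurable_fun [set: X] (iter n T).
Proof.
elim: n => [|n IH] /=; first exact: measurable_id.
by apply: measurableT_comp IH; case: (yt_preserving HY).
Qed.

Lemma mu_iter n (B : set X) : measurable B -> mu (iter n T @^-1` B) = mu B.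
Proof.
have [mT pT] := yt_preserving HY.
move=> mB; elim: n => [//|n IH].
rewrite -IH -[RHS]pT.
  by congr (mu _); apply: funext => x; rewrite /preimage /= -iterSr.
by rewrite -[X in measurable X]setTI; apply: measurable_iter.
Qed.

Lemma mu_base_level n : (0 < n)%N -> mu (level Y n 0) = (tail mu Y n)%:E.
Proof.
move=> n0.
have E (a : tower_index Y) x : cell a 0 x -> return_time Y x = height a.
  move=> ax; rewrite /return_time; apply: get_unique => [|m [b bx ->]].
    by exists a.
  by have [->] := cell_unique (yt_height HY a) (yt_height HY b) ax bx.
have LE : [set x | base Y x /\ (n <= return_time Y x)%N] = level Y n 0.
  apply/seteqP; split => x.
    by move=> /= [[a _ ax]]; rewrite (E a) // => na; exists a.
  by move=> [a /= na ax]; split; [exists a|rewrite (E a)].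
rewrite /tail LE fineK // fin_num_measure //.
exact: measurable_level.
Qed.

(** By invariance, the levels of a column all have the mass of its base. *)
Lemma mu_level H l : (l < H)%N -> mu (level Y H l) = (tail mu Y H)%:E.
Proof.
move=> lH; rewrite -mu_base_level ?(leq_ltn_trans _ lH) // -(mu_iter l);
  last exact: measurable_level.
by congr (mu _); apply: funext => x; exact: (level_iter (l := 0%N) (i := l)).
Qed.

Lemma tail_ge0 n : 0 <= tail mu Y n.
Proof. by rewrite fine_ge0. Qed.

Lemma same_cell_tall L x y : same_cell Y x y -> tall Y L x -> tall Y L y.
Proof.
move=> [[a i] /= ia [ax ay]] [l _ [b /= + bx]].
rewrite geq_max => /andP[Lb lb].
have [ab il] := cell_unique ia lb ax bx; move: ay; rewrite ab il => ay.
by exists l => //; exists b => //=; rewrite geq_max Lb.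
Qed.

Lemma tall_ge H L l x : (l < H)%N -> (L <= H)%N -> level Y H l x -> tall Y L x.
Proof.
move=> lH LH [a /= Ha ax]; exists l => //; exists a => //=.
by rewrite (leq_trans _ Ha) // geq_max LH.
Qed.

(** The mass of the tall columns is at most [sum_l tail (max L (l+1))]: the
    levels [l < L] contribute [L * tail L], the higher ones a tail sum of the
    convergent series [sum_k k ^ (- p - 1)]. *)
Lemma mu_tall_le (p C2 : R) L : 0 < p -> (0 < L)%N ->
  (forall n, (L <= n)%N -> tail mu Y n <= C2 * n%:R `^ (- p - 1)) ->
  fine (mu (tall Y L)) <= C2 * (1 + p^-1) * L%:R `^ (- p).
Proof.
move=> p0 L0 tailC.
have L0R : 0 < L%:R :> R by rewrite ltr0n.
have C20 : 0 <= C2.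
  have := le_trans (tail_ge0 L) (tailC L (leqnn L)).
  by rewrite pmulr_lge0 // powR_gt0.
have lmax l : (l < maxn L l.+1)%N by rewrite leq_max ltnSn orbT.
rewrite -lee_fin fineK; last first.
  by rewrite fin_num_measure //; exact: measurable_tall.
have := measure_sigma_subadditive mu (fun l => measurable_level (lmax l))
  (measurable_tall L) (@subset_refl _ (tall Y L)).
move=> /le_trans; apply; apply: lime_le; first exact: is_cvg_nneseries.
near=> N.
have LN : (L <= N)%N by near: N; exact: nbhs_infty_ge.
rewrite (eq_bigr (fun l => (tail mu Y (maxn L l.+1))%:E)); last first.
  by move=> l _; exact: mu_level.
rewrite sumEFin lee_fin (big_cat_nat (n := L)) //= mulrDr mulr1 mulrDl.
apply: lerD.
  rewrite big_nat (eq_bigr (fun=> tail mu Y L)); last first.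
    by move=> i /andP[_ iL]; congr tail; exact/maxn_idPl.
  rewrite -big_nat sumr_const_nat subn0 -[leLHS]mulr_natr.
  apply: le_trans (ler_wpM2r (ltW L0R) (tailC L (leqnn L))) _.
  rewrite powRB; last by rewrite pnatr_eq0 -lt0n L0 implybT.
  by rewrite (powRr1 (ltW L0R)) -mulrA divfK // gt_eqF.
apply: (@le_trans _ _ (\sum_(L <= k < N) C2 * k.+1%:R `^ (- p - 1))).
  apply: ler_sum_nat => i /andP[Li _].
  have Li1 : (L <= i.+1)%N by rewrite leqW.
  by rewrite (maxn_idPr Li1) tailC.
rewrite -mulr_sumr -mulrA ler_wpM2l // mulrC.
exact: sum_powR_tail.
Unshelve. all: by end_near.
Qed.

End measured_columns.

(** * The centred indicator of the tall columns *)

Section moments.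
Context {R : realType} {d : measure_display} {X : measurableType d}.
Context (mu : probability X R) (Y : tower R X).
Context (HY : young_tower mu Y).
Implicit Types (H L i l n : nat).
Local Notation T := (tower_map Y).

Definition tall_mass L : R := fine (mu (tall Y L)).

Definition tall_obs L (x : X) : R := \1_(tall Y L) x - tall_mass L.

Definition visits L n (x : X) : R := \sum_(i < n) \1_(tall Y L) (iter i T x).

Lemma mu_tall L : mu (tall Y L) = (tall_mass L)%:E.
Proof.
rewrite /tall_mass fineK // fin_num_measure //.
exact: (measurable_tall HY).
Qed.

Lemma tall_mass_itv L : 0 <= tall_mass L <= 1.
Proof.
rewrite fine_ge0 //= -lee_fin -mu_tall.
by apply: probability_le1; exact: (measurable_tall HY).
Qed.

Lemma integral_const (r : R) : (\int[mu]_x r%:E = r%:E)%E.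
Proof.
rewrite (integral_cst mu measurableT) -[RHS]mule1; congr (_ * _)%E.
exact: probability_setT.
Qed.

(** The observable is constant on partition elements: the seminorm vanishes. *)
Lemma lip_norm_tall_obs L : (lip_norm Y (tall_obs L) <= 1)%E.
Proof.
have /andP[m0 m1] := tall_mass_itv L.
rewrite /lip_norm -[leRHS]adde0; apply: leeD.
  apply: ge_ereal_sup => _ [x _ <-]; rewrite lee_fin /tall_obs indicE.
  by case: (_ \in _) => /=; rewrite ler_norml; lra.
rewrite /lip_seminorm ge_max lexx /=.
apply: ge_ereal_sup => _ [x [y [xy _ ->]]].
suff -> : tall_obs L x = tall_obs L y by rewrite subrr normr0 mul0r.
rewrite /tall_obs !indicE; congr (_ %:R - _); congr nat_of_bool.
apply/idP/idP; rewrite !inE; first exact: (same_cell_tall HY xy).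
apply: (same_cell_tall HY); case: xy => p ? [? ?]; by exists p.
Qed.

Lemma integral_tall_obs L : (\int[mu]_x (tall_obs L x)%:E = 0)%E.
Proof.
have mt := measurable_tall HY L.
rewrite /tall_obs; under eq_integral do rewrite EFinB.
rewrite integralB_EFin //=; first last.
- exact: finite_measure_integrable_cst.
- exact: integrable_indic.
have -> : (\int[mu]_x (\1_(tall Y L) x)%:E = (tall_mass L)%:E)%E.
  by rewrite integral_indic // setIT; exact: mu_tall.
by rewrite integral_const subee.
Qed.

Lemma birkhoff_tall_obs L n x :
  birkhoff_sum T n (tall_obs L) x = visits L n x - n%:R * tall_mass L.
Proof.
rewrite /birkhoff_sum /tall_obs sumrB sumr_const card_ord /visits.
by rewrite mulr_natl.
Qed.

Lemma measurable_visit (B : set X) i : measurable B ->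
  measurable_fun [set: X] (fun x => \1_B (iter i T x) : R).
Proof.
move=> mB; apply: measurableT_comp (measurable_iter HY i).
exact: measurable_indic.
Qed.

Lemma measurable_visits L n : measurable_fun [set: X] (visits L n).
Proof.
apply: measurable_sum => i; apply: measurable_visit.
exact: (measurable_tall HY).
Qed.

Lemma measurable_moment (q : R) L n : measurable_fun [set: X]
  (fun x => (`|birkhoff_sum T n (tall_obs L) x| `^ q)%:E).
Proof.
apply/measurable_EFinP.
apply: (measurableT_comp (measurable_powR q)).
apply: measurableT_comp; first exact: normr_measurable.
have -> : birkhoff_sum T n (tall_obs L) =
    fun x => visits L n x - n%:R * tall_mass L.
  by apply: funext => x; exact: birkhoff_tall_obs.
by apply: measurable_funB => //; exact: measurable_visits.
Qed.

Lemma visits_ge0 L n x : 0 <= visits L n x.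
Proof. by apply: sumr_ge0 => i _; rewrite indicE. Qed.

(** The last [l + 1] iterates up to time [i] form the climb that leads to level
    [l], and the whole climb takes place in the same tall column. *)
Lemma visits_ge L n l i x : (l <= i)%N -> (i < n)%N ->
  level Y (maxn L l.+1) l (iter i T x) -> l.+1%:R <= visits L n x.
Proof.
move=> li iN lev; rewrite /visits.
rewrite -(big_mkord xpredT (fun k => \1_(tall Y L) (iter k T x))).
have il0 : (i - l <= i.+1)%N by rewrite leqW // leq_subr.
rewrite (big_cat_nat (n := (i - l)%N)) ?(leq_trans il0) //=.
rewrite ler_wpDl //; first by apply: sumr_ge0 => k _; rewrite indicE.
rewrite (big_cat_nat (n := i.+1)) //= ler_wpDr //.
  by apply: sumr_ge0 => k _; rewrite indicE.
rewrite big_nat (eq_bigr (fun=> 1)).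
  by rewrite -big_nat sumr_const_nat subSn ?leq_subr // subKn.
move=> k /andP[lk ki]; rewrite indicE mem_set //.
have ik : (i - k <= l)%N by rewrite leq_subLR addnC -leq_subLR.
have lH : (l < maxn L l.+1)%N by rewrite leq_max ltnSn orbT.
apply: (tall_ge (H := maxn L l.+1) (l := (l - (i - k))%N)).
- by rewrite (leq_ltn_trans _ lH) // leq_subr.
- by rewrite leq_maxl.
by rewrite -(level_iter HY (i := (i - k)%N)) subnK // -iterD subnK.
Qed.

Lemma level_unique H H' l l' x : (l < H)%N -> (l' < H')%N ->
  level Y H l x -> level Y H' l' x -> l = l'.
Proof.
move=> lH lH' [a /= Ha ax] [b /= Hb bx].
by have [] := cell_unique HY (leq_trans lH Ha) (leq_trans lH' Hb) ax bx.
Qed.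

(** A lower substitute for [visits L n x ^ q] that is linear in indicators of
    levels, so that its integral is explicit.  Levels [l > i] are left out: there
    the excursion began before time [0]. *)
Definition excursion_moment (q : R) L n (x : X) : R :=
  \sum_(i < n) \sum_(l < i.+1)
    l.+1%:R `^ (q - 1) * \1_(level Y (maxn L l.+1) l) (iter i T x).

(** Write [W := visits L n x] and [W ^ q] as the sum over [i] of
    [1_(tall)(T^i x) W ^ (q - 1)].  For each [i] at most one level [l] contributes
    to the left-hand side, and then [W >= l + 1]. *)
Lemma excursion_moment_le (q : R) L n x (q1 : 1 < q) :
  excursion_moment q L n x <= visits L n x `^ q.
Proof.
have q0 : 0 < q by lra.
rewrite -(mulr_powRB1 (visits_ge0 L n x) q0) {1}/visits mulr_suml.
apply: ler_sum => i _.
have lH l : (l < maxn L l.+1)%N by rewrite leq_max ltnSn orbT.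
have [[l0 lev]|nolev] := pselect (exists l : 'I_i.+1,
    level Y (maxn L l.+1) l (iter i T x)); last first.
  rewrite big1; first by rewrite mulr_ge0 ?powR_ge0 // indicE.
  move=> l _; rewrite indicE memNset ?mulr0 // => lev.
  by apply: nolev; exists l.
rewrite (bigD1 l0) //= [X in _ + X]big1 ?addr0; last first.
  move=> l ll0; rewrite indicE memNset ?mulr0 // => lev'.
  by move/eqP: ll0; apply; apply: val_inj; exact: level_unique lev' lev.
rewrite !indicE mem_set // mem_set; last first.
  by apply: tall_ge lev => //; rewrite leq_maxl.
rewrite mulr1 mul1r ge0_ler_powR ?nnegrE ?visits_ge0 //; first lra.
by apply: visits_ge lev => //; rewrite -ltnS.
Qed.

Lemma integral_excursion_moment (q : R) L n :
  (\int[mu]_x (excursion_moment q L n x)%:E =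
   (\sum_(i < n) \sum_(l < i.+1)
     l.+1%:R `^ (q - 1) * tail mu Y (maxn L l.+1))%:E)%E.
Proof.
have lH l : (l < maxn L l.+1)%N by rewrite leq_max ltnSn orbT.
have mlev i l : measurable_fun [set: X]
    (fun x => \1_(level Y (maxn L l.+1) l) (iter i T x) : R).
  by apply: measurable_visit; exact: (measurable_level HY).
have msum i l : measurable_fun [set: X] (fun x => l.+1%:R `^ (q - 1) *
    \1_(level Y (maxn L l.+1) l) (iter i T x) : R).
  exact: measurable_funM.
rewrite /excursion_moment; under eq_integral do rewrite -sumEFin.
rewrite ge0_integral_sum //=; first last.
- move=> i x _; rewrite lee_fin; apply: sumr_ge0 => l _.
  by rewrite mulr_ge0 ?powR_ge0 // indicE.
- move=> i; apply/measurable_EFinP; exact: measurable_sum.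
rewrite -sumEFin; apply: eq_bigr => i _.
under eq_integral do rewrite -sumEFin.
rewrite ge0_integral_sum //=; last by move=> l; exact/measurable_EFinP.
rewrite -sumEFin; apply: eq_bigr => l _.
under eq_integral do rewrite EFinM.
rewrite ge0_integralZl_EFin //; last exact/measurable_EFinP.
rewrite EFinM; congr (_ * _)%E.
rewrite -(mu_level HY (lH l)) -(mu_iter HY i); last exact: (measurable_level HY).
rewrite -[X in _ = mu X]setIT -integral_indic //.
rewrite -[X in measurable X]setTI.
by apply: (measurable_iter HY) => //; exact: (measurable_level HY).
Qed.

(** The centring is removed through [W <= |S_n f| + n m]. *)
Lemma moment_lower_bound (q : R) L n : 1 < q ->
  ((\sum_(i < n) \sum_(l < i.+1)
     l.+1%:R `^ (q - 1) * tail mu Y (maxn L l.+1))%:E <=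
   (2 `^ q)%:E * (\int[mu]_x (`|birkhoff_sum T n (tall_obs L) x| `^ q)%:E
     + ((n%:R * tall_mass L) `^ q)%:E))%E.
Proof.
move=> q1; have q0 : 0 <= q by lra.
have nm0 : 0 <= n%:R * tall_mass L.
  by rewrite mulr_ge0 //; case/andP: (tall_mass_itv L).
rewrite -integral_excursion_moment.
have <- : (\int[mu]_x ((n%:R * tall_mass L) `^ q)%:E =
    ((n%:R * tall_mass L) `^ q)%:E)%E by exact: integral_const.
have mM := measurable_moment q L n.
rewrite -ge0_integralD //; last by move=> x _; rewrite lee_fin powR_ge0.
rewrite -ge0_integralZl //; first last.
- by move=> x _; rewrite adde_ge0 // lee_fin powR_ge0.
- by apply: emeasurable_funD.
apply: ge0_le_integral => //.
- move=> x _; rewrite lee_fin; apply: sumr_ge0 => i _; apply: sumr_ge0 => l _.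
  by rewrite mulr_ge0 ?powR_ge0 // indicE.
- apply/measurable_EFinP; apply: measurable_sum => i; apply: measurable_sum => l.
  apply: measurable_funM => //.
  apply: measurable_visit; apply: (measurable_level HY).
  by rewrite leq_max ltnSn orbT.
- apply: measurable_funeM; exact: emeasurable_funD.
move=> x _; rewrite -EFinD -EFinM lee_fin.
apply: le_trans (excursion_moment_le L n x q1) _.
apply: le_trans (powRD_le q0 (normr_ge0 _) nm0).
rewrite ge0_ler_powR ?nnegrE ?visits_ge0 ?addr_ge0 //.
rewrite birkhoff_tall_obs -lerBlDr; exact: ler_norm.
Qed.

(** From the base of a column of height at least [H] the orbit stays in [tall L]
    up to time [n <= H], so there [S_n f = n (1 - m) >= 1 / 2]. *)
Lemma moment_ge_of_tall (q : R) L H n : 0 <= q -> (L <= H)%N ->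
  (0 < n <= H)%N -> tall_mass L <= 2^-1 ->
  ((2^-1 `^ q * tail mu Y H)%:E <=
    \int[mu]_x (`|birkhoff_sum T n (tall_obs L) x| `^ q)%:E)%E.
Proof.
move=> q0 LH /andP[n0 nH] m2; have H0 : (0 < H)%N by rewrite (leq_trans n0).
have mB := measurable_level HY H0.
rewrite EFinM -(mu_level HY H0) -[X in (_ * mu X)%E]setIT -integral_indic //.
rewrite -ge0_integralZl_EFin //; last first.
  exact/measurable_EFinP/measurable_indic.
apply: ge0_le_integral => //.
- by apply: measurable_funeM; exact/measurable_EFinP/measurable_indic.
- exact: measurable_moment.
move=> x _; rewrite -EFinM lee_fin indicE.
case: (boolP (x \in _)) => xB; last by rewrite mulr0 powR_ge0.
rewrite mulr1 ge0_ler_powR ?nnegrE //.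
have -> : birkhoff_sum T n (tall_obs L) x = n%:R * (1 - tall_mass L).
  rewrite birkhoff_tall_obs mulrBr mulr1 /visits (eq_bigr (fun=> 1)).
    by rewrite sumr_const card_ord.
  move=> i _; have iH := leq_trans (ltn_ord i) nH.
  rewrite indicE mem_set //; apply: (tall_ge iH LH).
  by rewrite -[X in level Y H X]add0n (level_iter HY) //; move: xB; rewrite inE.
have n1 : 1 <= n%:R :> R by rewrite ler1n.
by rewrite ger0_norm; nra.
Qed.

End moments.

(** * Moments of order n ln n *)

Section large_times.
Context {R : realType} {d : measure_display} {X : measurableType d}.
Context (mu : probability X R) (Y : tower R X).
Context (HY : young_tower mu Y).
Local Notation T := (tower_map Y).

(** The threshold [L] is [n ^ (1 / q)] up to a factor 2.  It balances the two
    sides: [n * m <= M * n ^ (1 / q)] contributes at most [M ^ q * n] after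
    raising to the power [q], and [ln L <= ln 2 + ln n / q] leaves the fraction
    [1 - 1 / q] of [ln n]. *)
Lemma moment_ge_ln (q c M : R) (K n : nat) : 1 < q -> 0 < c -> 0 <= M ->
  (forall k, (K <= k)%N -> c * k%:R `^ (- q) <= tail mu Y k) ->
  (forall L, (0 < L)%N -> (K <= L)%N ->
    tall_mass mu Y L <= M * L%:R `^ (- (q - 1))) ->
  (0 < n)%N -> K%:R `^ q <= n%:R ->
  exists L,
    (((c * (1 - q^-1) / 2 / 2 `^ q * ln n%:R -
        (c * ln 2 / 2 `^ q + M `^ q)) * n%:R)%:E <=
     \int[mu]_x (`|birkhoff_sum T n (tall_obs mu Y L) x| `^ q)%:E)%E.
Proof.
move=> q1 c0 M0 tailc massM n0 Kn; have q0 : 0 < q by lra.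
have n0R : 0 < n%:R :> R by rewrite ltr0n.
have n1R : 1 <= n%:R :> R by rewrite ler1n.
pose a : R := n%:R `^ q^-1.
have a1 : 1 <= a by rewrite -(powRr0 n%:R) ler_powR // invr_ge0 ltW.
have a0 : 0 < a by lra.
have aq : a `^ q = n%:R by rewrite -powRrM mulVf ?powRr1 ?gt_eqF // ltW.
pose L := (Num.truncn a).+1; exists L.
have aL : a <= L%:R by exact/ltW/truncnS_gt.
have La : L%:R <= 2 * a.
  have := truncn_le a; rewrite (ltW a0) /L -natr1 => la.
  by have : (Num.truncn a)%:R <= a by []; lra.
have KL : (K <= L)%N.
  rewrite -(ler_nat R) (le_trans _ aL) // leNgt; apply/negP => aK.
  have : a `^ q < K%:R `^ q by rewrite gt0_ltr_powR ?nnegrE // ltW.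
  by rewrite aq ltNge Kn.
have L0 : (0 < L)%N by [].
have tailL k : (L <= k)%N -> c * k%:R `^ (- q) <= tail mu Y k.
  by move=> Lk; apply: tailc; exact: leq_trans Lk.
have S := sum_weighted_tail_ge (ltW c0) L0 (@tail_ge0 _ _ _ mu Y) tailL n0.
have Q := moment_lower_bound HY L n q1.
have mass : (n%:R * tall_mass mu Y L) `^ q <= M `^ q * n%:R.
  have /andP[m0 _] := tall_mass_itv HY L.
  rewrite -[in leRHS]aq -powRM // ?(ltW a0) //.
  rewrite ge0_ler_powR ?nnegrE ?mulr_ge0 // ?(ltW q0) ?(ltW a0) //.
  apply: le_trans (ler_wpM2l (ltW n0R) (massM _ L0 KL)) _.
  rewrite mulrCA ler_wpM2l //.
  rewrite powRN ler_pdivrMr ?powR_gt0 ?ltr0n //.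
  apply: (@le_trans _ _ (a * a `^ (q - 1))).
    by rewrite mulr_powRB1 ?aq // ltW.
  rewrite ler_wpM2l ?(ltW a0) // ge0_ler_powR ?nnegrE ?(ltW a0) //; lra.
have lnL : ln L%:R <= ln 2 + q^-1 * ln n%:R.
  by rewrite -ln_powR -lnM ?posrE // ler_ln ?posrE ?mulr_gt0 // ltr0n.
have P0 : 0 < 2 `^ q :> R by rewrite powR_gt0.
apply: le_trans (lee_of_le_scale_add P0 Q); rewrite lee_fin.
have -> : (c * (1 - q^-1) / 2 / 2 `^ q * ln n%:R -
      (c * ln 2 / 2 `^ q + M `^ q)) * n%:R =
    n%:R / 2 * (c * (ln n%:R - ln 2 - (ln 2 + q^-1 * ln n%:R))) / 2 `^ q -
      M `^ q * n%:R.
  by field; rewrite !gt_eqF.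
apply: lerB => //; rewrite ler_wpM2r ?invr_ge0 ?powR_ge0 //.
apply: le_trans S; rewrite ler_wpM2l ?divr_ge0 //.
by rewrite ler_wpM2l ?(ltW c0) // lerB.
Qed.

End large_times.

Theorem proposition1p3 (R : realType) (d : measure_display)
    (X : measurableType d) (mu : probability X R) (Y : tower R X)
    (C q eps : R) :
  young_tower mu Y ->
  0 < C -> 1 < q < 2 -> 0 < eps ->
  (fun n : nat => tail mu Y n - C * n%:R `^ (- q))
    =O_\oo (fun n : nat => n%:R `^ (- q - eps)) ->
  exists2 c : R, 0 < c &
    forall n : nat, (0 < n)%N ->
      ((c * (n%:R * ln n%:R))%:E <=
       ereal_sup [set (\int[mu]_x
                         (`|birkhoff_sum (tower_map Y) n f x| `^ q)%:E)%E
                 | f in [set f : X -> R |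
                     (lip_norm Y f <= 1)%E /\ \int[mu]_x (f x)%:E = 0%E]])%E.
Proof.
move=> HY C0 /andP[q1 _] eps0 /(bigO_tail_bounds C0 eps0)[K tailK].
have q0 : 0 < q by lra.
have p0 : 0 < q - 1 by lra.
have P0 : 0 < 2 `^ q :> R by rewrite powR_gt0.
pose F n : \bar R := (ereal_sup [set
  (\int[mu]_x (`|birkhoff_sum (tower_map Y) n f x| `^ q)%:E)%E
  | f in [set f : X -> R |
      (lip_norm Y f <= 1)%E /\ \int[mu]_x (f x)%:E = 0%E]])%E.
have FE n L : (\int[mu]_x
    (`|birkhoff_sum (tower_map Y) n (tall_obs mu Y L) x| `^ q)%:E <= F n)%E.
  apply: ereal_sup_ubound; exists (tall_obs mu Y L) => //=; split.
    exact: lip_norm_tall_obs.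
  exact: integral_tall_obs.
pose c1 := C / 2; have c10 : 0 < c1 by rewrite divr_gt0.
pose M := 2 * C * (1 + (q - 1)^-1).
have M0 : 0 < M by rewrite !mulr_gt0 // ltr_wpDr // invr_ge0 ltW.
have tail_ge k : (K <= k)%N -> c1 * k%:R `^ (- q) <= tail mu Y k.
  by move=> /tailK /andP[].
have massM L : (0 < L)%N -> (K <= L)%N ->
    tall_mass mu Y L <= M * L%:R `^ (- (q - 1)).
  move=> L0 KL; apply: (mu_tall_le HY p0 L0) => n Ln.
  have -> : - (q - 1) - 1 = - q by ring.
  by have /andP[] := tailK _ (leq_trans KL Ln).
clearbody c1 M.
pose a := c1 * (1 - q^-1) / 2 / 2 `^ q.
have a0 : 0 < a by rewrite !divr_gt0 // mulr_gt0 // subr_gt0 invf_lt1.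
pose b := c1 * ln 2 / 2 `^ q + M `^ q.
(* From [N] on, [ln n >= 2 b / a], hence [a ln n - b >= (a / 2) ln n]. *)
pose N := (Num.truncn (K%:R `^ q + expR (2 * b / a))).+1.
have HN n : (N <= n)%N -> K%:R `^ q + expR (2 * b / a) <= n%:R.
  move=> Nn; apply: (@le_trans _ _ N%:R); first exact/ltW/truncnS_gt.
  by rewrite ler_nat.
have large n : (N <= n)%N -> ((a / 2 * (n%:R * ln n%:R))%:E <= F n)%E.
  move=> Nn; have n0 : (0 < n)%N by exact: leq_trans Nn.
  have n0R : 0 < n%:R :> R by rewrite ltr0n.
  have := HN n Nn; have := expR_gt0 (2 * b / a); have := powR_ge0 (K%:R : R) q.
  move=> k0 e0 Hn.
  have [|L HL] := moment_ge_ln HY q1 c10 (ltW M0) tail_ge massM n0;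
    first by lra.
  apply: le_trans (FE n L); apply: le_trans HL; rewrite lee_fin -/a -/b.
  rewrite mulrCA mulrC ler_wpM2r ?(ltW n0R) //.
  have : 2 * b / a <= ln n%:R.
    by rewrite -[leLHS]expRK ler_ln ?posrE //; lra.
  by rewrite ler_pdivrMr // => ?; lra.
have [N' HN'] := eventually_powR_small p0
  (divr_gt0 (@ltr01 R) (mulr_gt0 (ltr0Sn R 1) M0)).
(* For [n < N], one [L] and one bound [r] serve all times. *)
pose L := maxn 1 (maxn K N').
have L0 : (0 < L)%N by rewrite leq_max.
have KL : (K <= L)%N by rewrite !leq_max leqnn orbT.
have massL : tall_mass mu Y L <= 2^-1.
  apply: le_trans (massM L L0 KL) _.
  have /HN' : (N' <= L)%N by rewrite !leq_max leqnn !orbT.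
  rewrite ler_pdivlMr ?mulr_gt0 // => ?; lra.
pose H := maxn L N.
have H0 : (0 < H)%N by rewrite leq_max L0.
pose r := 2^-1 `^ q * tail mu Y H.
have r0 : 0 < r.
  rewrite mulr_gt0 ?powR_gt0 // (lt_le_trans _ (tail_ge H _)) //.
    by rewrite mulr_gt0 // powR_gt0 // ltr0n.
  by rewrite (leq_trans KL) // leq_maxl.
(* A crude bound for [n ln n] when [n < N]. *)
pose B := 1 + N%:R * N%:R : R.
have B0 : 0 < B by rewrite ltr_pwDl // mulr_ge0.
exists (Num.min (a / 2) (r / B)).
  by rewrite lt_min (divr_gt0 r0 B0) (divr_gt0 a0).
move=> n n0; have n0R : 0 < n%:R :> R by rewrite ltr0n.
have nln0 : 0 <= n%:R * ln n%:R :> R by rewrite mulr_ge0 // ln_ge0 // ler1n.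
have [Nn|nN] := leqP N n.
  apply: le_trans (large n Nn); rewrite lee_fin ler_wpM2r //.
  by rewrite ge_min lexx.
apply: le_trans (FE n L).
have nH : (0 < n <= H)%N by rewrite n0 /= leq_max (ltnW nN) orbT.
apply: le_trans (moment_ge_of_tall HY (ltW q0) (leq_maxl L N) nH massL).
rewrite lee_fin -/r; apply: (@le_trans _ _ (r / B * B)); last first.
  by rewrite divfK // gt_eqF.
apply: ler_pM => //.
  by rewrite le_min (ltW (divr_gt0 r0 B0)) (ltW (divr_gt0 a0 _)).
  by rewrite ge_min lexx orbT.
have nNR : n%:R <= N%:R :> R by rewrite ler_nat ltnW.
have := ln_sublinear n0R; rewrite /B => ?.
by nra.
Qed.
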